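(* There exist absolute constants $c>0$ such that the following holds. Let $A$ be a finite set of real numbers (with $|A|\ge 2$, so that $\log|A|>0$). Then $$\left| \frac{A+A}{A+A} \right| \geq c\, \frac{|A|^{2+\frac{2}{25}}}{|A:A|^{\frac{1}{25}}\log |A|}.$$ In particular, for every constant $K>0$ there is a constant $c_K>0$ such that if $\left| \frac{A+A}{A+A} \right| \le K|A|^2$, then $|A:A| \geq c_K\frac{|A|^2}{\log^{25}|A|}$.
   Context: For a finite set $A\subset\mathbb R$, $\frac{A+A}{A+A}:=\left\{\frac{a+b}{c+d}: a,b,c,d\in A,\ c+d\neq 0\right\}$ and the ratio set is $A:A:=\{a/b: a,b\in A,\ b\neq 0\}$. Logarithms are base $2$. The paper writes the bounds as $X\gg Y$, meaning $X\ge cY$ for an absolute constant $c>0$ (in the second statement the implied constant may depend on the implied constant of the hypothesis). *)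

(* Defs.v *)
From mathcomp Require Import all_boot all_order all_algebra finmap.
From mathcomp Require Export reals exp.

Set Implicit Arguments.
Unset Strict Implicit.
Unset Printing Implicit Defensive.

Import Order.TTheory GRing.Theory Num.Theory.
Local Open Scope fset_scope.
Local Open Scope ring_scope.

Section FiniteSets.
Variable R : realType.
Implicit Types A B : {fset R}.

Definition sumset A B : {fset R} := [fset a + b | a in A, b in B].

Definition ratioset A B : {fset R} := [fset a / b | a in A, b in B & b != 0].

Definition log2 (x : R) : R := ln x / ln 2.

(* This is the set of (a + b) / (c + d) with
   a, b, c, d in A and c + d != 0. *)
Definition sum_ratioset A : {fset R} := ratioset (sumset A A) (sumset A A).

Lemma ratiosetP A B (x : R) :
  reflect (exists a b, [/\ a \in A, b \in B, b != 0 & x = a / b])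
          (x \in ratioset A B).
Proof.
apply: (iffP (imfset2P _ _ _ _ _)) => [[a aA [b]]|[a [b [aA bB b0 ->]]]].
  by rewrite inE /= => /andP[bB b0] ->; exists a, b.
by exists a => //; exists b => //; rewrite inE /= bB.
Qed.

Lemma sum_ratiosetP A (x : R) :
  reflect (exists a b c d, [/\ [/\ a \in A, b \in A, c \in A & d \in A],
                               c + d != 0 & x = (a + b) / (c + d)])
          (x \in sum_ratioset A).
Proof.
apply: (iffP (ratiosetP _ _ _)) => [[s [t []]]|].
  move=> /imfset2P[a aA [b bA ->]] /imfset2P[c cA [d dA ->]] ? ->.
  by exists a, b, c, d.
move=> [a [b [c [d [[aA bA cA dA] cd ->]]]]]; exists (a + b), (c + d).
by split=> //; apply/imfset2P;
  [exists a => //; exists b | exists c => //; exists d].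
Qed.

End FiniteSets.

(* Main.v *)
(* Replace A by its positive or negative part and let A_l be the set of the x in A
   with l x in A. For slopes l < l', adding a point of A x A on the line of slope l
   to one on the line of slope l' gives a slope of (A + A) x (A + A), an element
   (l x + l' y) / (x + y) of (A + A) / (A + A) strictly between l and l'. After a
   dyadic pigeonholing (which costs the logarithm) all lines carry about
   tau >= |A|^2 / (4 |A : A|) points. Cut the sorted slopes into clusters of m
   consecutive ones: distinct clusters produce disjoint sets of sums. Inside a
   cluster, either some pair of lines gives m^2 tau values by itself, or each of the
   ~ m^2 pairs gives at least tau / 2 values with >= tau / (2 m^2) representations.
   The popular values common to two pairs are incidences between a tau x tau grid
   and tau^2 increasing hyperbola arcs, at most two of them through any two points,
   so they are O(m^4 (tau / q + q^2)) in number for every q; with q ~ m^6 they are negligible as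
   soon as m^18 << tau. Every cluster thus gives >> m^2 tau values, in total
   >> m |A|^2 / log |A|, with m of order tau^(1/18), better than the needed
   tau^(1/25). *)

Require Import Defs.
From mathcomp Require Import all_boot all_order all_algebra finmap.
From mathcomp Require Import reals exp.
From mathcomp Require Import zify ring lra.

Set Implicit Arguments.
Unset Strict Implicit.
Unset Printing Implicit Defensive.

Import Order.TTheory GRing.Theory Num.Theory.

(** * Double counting and incidences with increasing curves on a grid *)

(** Induction on [P]: deleting one point of a colliding pair costs one element of [P] and removes at
    least one ordered collision from the count. *)
Lemma card_le_collisions (T V : finType) (f : T -> V) (P : {set T}) (D : {set V}) :
  {in P, forall x, f x \in D} ->
  #|P| <= #|D| + #|[set w : T * T | [&& w.1 \in P, w.2 \in P, w.1 != w.2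
                                      & f w.1 == f w.2]]|.
Proof.
have [n] := ubnP #|P|; elim: n P => // n IHn P leP fD.
have [/dinjectiveP inj_f|/dinjectivePn[x xP [y /andP[yx yP] fxy]]] :=
    boolP (dinjectiveb f P).
  rewrite -(card_in_imset inj_f) (leq_trans _ (leq_addr _ _))//.
  by apply/subset_leq_card/subsetP => _ /imsetP[x xP ->]; exact: fD.
rewrite (cardsD1 x) xP (leq_trans (leq_add (leqnn 1) (IHn (P :\ x) _ _)))//.
- by move: leP; rewrite (cardsD1 x P) xP.
- by move=> z /setD1P[_]; exact: fD.
rewrite addnCA leq_add2l.
set W := [set w | _]; set W' := [set w | _].
rewrite -(_ : #|(x, y) |: W| = 1 + #|W|); last first.
  by rewrite cardsU1 !inE/= eqxx.
apply/subset_leq_card/subsetP => -[a b]; rewrite !inE/= => /orP[/eqP[-> ->]|].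
  by rewrite xP yP fxy eqxx eq_sym yx.
by case/and4P => /andP[_ ->] /andP[_ ->] -> ->.
Qed.

Lemma card_divn_fiber (N q e : nat) :
  0 < q -> #|[set a : 'I_N | a %/ q == e]| <= q.
Proof.
move=> q0; rewrite -[leqRHS]card_ord.
pose f (a : 'I_N) := Ordinal (ltn_pmod a q0).
rewrite -(card_in_imset (f := f)) ?max_card//.
move=> a b; rewrite !inE => /eqP ea /eqP eb [ab].
by apply/val_inj; rewrite /= (divn_eq a q) (divn_eq b q) ea eb ab.
Qed.

Lemma card_set_sum (T : finType) (P : pred T) : #|[set x | P x]| = \sum_x P x.
Proof. by rewrite cardsE -sum1_card big_mkcond. Qed.

(* Cut the grid into h x h square cells of side q. An increasing curve meets at
   most 2h - 1 of them, so a curve with many points has many pairs of points in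
   a common cell, while each such pair lies on at most two curves. *)
Lemma incidences_le (h q : nat) (C : finType)
    (I : 'I_(h * q) * 'I_(h * q) -> C -> bool) :
  0 < q -> 0 < h ->
  (forall c p p', I p c -> I p' c -> p.1 <= p'.1 -> p.2 <= p'.2) ->
  (forall p p', p != p' -> #|[set c | I p c && I p' c]| <= 2) ->
  \sum_c #|[set p | I p c]| <= #|C| * (2 * h) + 2 * (h * q * q) ^ 2.
Proof.
move=> q0 h0 mono two; set N := h * q in I mono two *.
pose cell (w : ('I_N * 'I_N) * ('I_N * 'I_N)) :=
  (w.1.1 %/ q == w.2.1 %/ q) && (w.1.2 %/ q == w.2.2 %/ q).
have ltdiv (a : 'I_N) : a %/ q < h by rewrite ltn_divLR.
have phiP (p : 'I_N * 'I_N) : p.1 %/ q + p.2 %/ q < 2 * h.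
  by have := ltdiv p.1; have := ltdiv p.2; lia.
(* [phi] adds the two cell coordinates. Along an increasing curve neither coordinate decreases, so
   two points with the same sum lie in the same cell. *)
pose phi p := Ordinal (phiP p).
have phi_cell c p p' : I p c -> I p' c -> phi p == phi p' -> cell (p, p').
  wlog le1 : p p' / p.1 <= p'.1.
    move=> H Ip Ip' e; case/orP: (leq_total p.1 p'.1) => le1; first exact: H.
    have := H _ _ le1 Ip' Ip; rewrite eq_sym => /(_ e).
    by rewrite /cell/= ![_ %/ _ == p.1 %/ _]eq_sym ![_ %/ _ == p.2 %/ _]eq_sym.
  move=> Ip Ip'; have le2 := mono _ _ _ Ip Ip' le1.
  rewrite /cell/= => /eqP[e].
  have := leq_div2r q le1; have := leq_div2r q le2.
  by move: e; lia.
have curve c : #|[set p | I p c]| <= 2 * h +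
    \sum_w (cell w && (w.1 != w.2) && (I w.1 c && I w.2 c)).
  apply: leq_trans (card_le_collisions (f := phi) (D := setT) _) _ => //.
  rewrite cardsT card_ord leq_add2l -card_set_sum.
  apply/subset_leq_card/subsetP => -[p p']; rewrite !inE/= => /and4P[Ip Ip' -> e].
  by rewrite Ip Ip' (phi_cell c).
apply: leq_trans; first by apply: leq_sum => c _; exact: curve.
rewrite big_split/= sum_nat_const leq_add2l exchange_big/=.
apply: (@leq_trans (\sum_w 2 * cell w)).
  apply: leq_sum => w _; case: (cell w) => /=; last by rewrite big1.
  have [_|ne] := eqVneq; first by rewrite big1.
  by rewrite -card_set_sum two.
rewrite -big_distrr leq_mul2l/= -(pair_bigA _ (fun p p' => nat_of_bool (cell (p, p'))))/=.
have cellc p : \sum_p' cell (p, p') <= q * q.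
  rewrite -card_set_sum.
  have -> : [set p' | cell (p, p')] =
     setX [set a : 'I_N | a %/ q == p.1 %/ q] [set a : 'I_N | a %/ q == p.2 %/ q].
    by apply/setP => -[a b]; rewrite !inE/= /cell/= ![p.1 %/ _ == _]eq_sym ![p.2 %/ _ == _]eq_sym.
  by rewrite cardsX leq_mul// card_divn_fiber.
apply: leq_trans; first by apply: leq_sum => p _; exact: cellc.
rewrite sum_nat_const card_prod !card_ord; lia.
Qed.

(** * Popular values, their overlaps and dyadic pigeonholing *)

(** Each value has at most [N] preimages, since the first coordinate of a preimage determines the
    second. Values with fewer than [t] preimages cover at most [K * t] of the [N ^ 2] pairs, hence
    at most half; the popular values cover the rest. *)
Lemma popular_card (V : finType) (N K t : nat) (f : 'I_N * 'I_N -> V) :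
  (forall a c c', f (a, c) = f (a, c') -> c = c') ->
  #|f @: [set: 'I_N * 'I_N]| <= K -> 2 * K * t <= N ^ 2 ->
  N <= 2 * #|[set u | t <= #|f @^-1: [set u]|]|.
Proof.
move=> inj_f imK Kt; set U := [set u | _].
have fib_le u : #|f @^-1: [set u]| <= N.
  rewrite -[leqRHS]card_ord -(card_in_imset (f := fst)) ?max_card//.
  by move=> [a c] [a' c']; rewrite !inE/= => /eqP<- /eqP e aa; subst a'; rewrite (inj_f a c' c).
have tot : N ^ 2 = \sum_u #|f @^-1: [set u]|.
  transitivity #|[set: 'I_N * 'I_N]|; first by rewrite cardsT card_prod card_ord.
  rewrite -sum1_card (partition_big f xpredT)//=; apply: eq_bigr => u _.
  by rewrite -sum1_card; apply: eq_bigl => p; rewrite !inE.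
have : N ^ 2 <= #|U| * N + K * t.
  rewrite tot (bigID (mem U))/= leq_add//.
    by rewrite -sum_nat_const leq_sum.
  rewrite (bigID (mem (f @: setT)))/= [X in _ + X]big1 ?addn0; last first.
    move=> u /andP[_ uf]; apply/eqP; rewrite cards_eq0 -subset0; apply/subsetP => p.
    by rewrite inE => /set1P pu; case/negP: uf; rewrite -pu imset_f.
  apply: (@leq_trans (\sum_(u in f @: setT) t)); last by rewrite sum_nat_const leq_mul2r imK orbT.
  rewrite big_mkcondl/=; apply: leq_sum => u _; rewrite inE -ltnNge.
  by case: ltnP => // /ltnW.
have [->//|N0] := posnP N.
move=> le1; have le2 : N * N <= (2 * #|U|) * N by lia.
by rewrite leq_pmul2r in le2.
Qed.

(** A value popular for both maps contributes at least [t ^ 2] solutions of [f w = g w']. Each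
    solution is regrouped: the two first coordinates form the point [p], the two second coordinates
    the curve [c]. *)
Lemma popular_overlap (V : finType) (N t : nat) (f g : 'I_N * 'I_N -> V) :
  #|[set u | t <= #|f @^-1: [set u]|] :&: [set u | t <= #|g @^-1: [set u]|]| * t ^ 2
  <= \sum_(c : 'I_N * 'I_N)
       #|[set p : 'I_N * 'I_N | f (p.1, c.1) == g (p.2, c.2)]|.
Proof.
pose W := [set w : ('I_N * 'I_N) * ('I_N * 'I_N) | f w.1 == g w.2].
apply: (@leq_trans #|W|).
  rewrite -[leqRHS]sum1_card (partition_big (fun w => f w.1) xpredT)//=.
  rewrite -sum_nat_const big_mkcond; apply: leq_sum => u _.
  case: ifP => //; rewrite !inE => /andP[tf tg].
  apply: (@leq_trans #|setX (f @^-1: [set u]) (g @^-1: [set u])|).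
    by rewrite cardsX leq_mul.
  rewrite sum1dep_card; apply/subset_leq_card/subsetP => w.
  by rewrite !inE => /andP[/eqP-> /eqP->]; rewrite !eqxx.
rewrite /W card_set_sum.
under [leqRHS]eq_bigr do rewrite card_set_sum.
rewrite pair_bigA/= leq_eqVlt; apply/orP; left; apply/eqP.
rewrite (reindex (fun v : ('I_N * 'I_N) * ('I_N * 'I_N) =>
  ((v.2.1, v.1.1), (v.2.2, v.1.2))))//=.
by exists (fun w => ((w.1.2, w.2.2), (w.1.1, w.2.1))) => -[[a b] [c d]].
Qed.
(** The left side counts pairs [(p, u)] with [u] in [U p]. Projecting to [u] lands in [D], and
    collisions occur only between distinct indices, at most [O] for each ordered pair of them. *)
Lemma sum_card_le_union (I V : finType) (P : {set I}) (U : I -> {set V})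
    (D : {set V}) (O : nat) :
  {in P, forall p, U p \subset D} ->
  {in P &, forall p p', p != p' -> #|U p :&: U p'| <= O} ->
  \sum_(p in P) #|U p| <= #|D| + #|P| ^ 2 * O.
Proof.
move=> UD UO; pose E := [set x : I * V | (x.1 \in P) && (x.2 \in U x.1)].
have -> : \sum_(p in P) #|U p| = #|E|.
  rewrite card_set_sum -(pair_bigA _ (fun p u => nat_of_bool ((p \in P) && (u \in U p))))/=.
  rewrite big_mkcond; apply: eq_bigr => p _; case: (p \in P) => /=; last by rewrite big1.
  by rewrite -card_set_sum; apply: eq_card => u; rewrite inE.
apply: leq_trans (card_le_collisions (f := snd) (D := D) _) _.
  by move=> [p u]; rewrite inE/= => /andP[pP]; apply/subsetP/UD.
rewrite leq_add2l; set W := [set w | _].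
rewrite -sum1_card (partition_big (fun w => (w.1.1, w.2.1)) (mem (setX P P)))/=; last first.
  by move=> [[p u] [p' u']]; rewrite !inE/= => /and4P[/andP[-> _] /andP[-> _]].
apply: (@leq_trans (\sum_(w in setX P P) O)); last first.
  by rewrite sum_nat_const cardsX.
apply: leq_sum => -[p p']; rewrite !inE/= => /andP[pP p'P]; rewrite sum1dep_card.
have [<-|ne] := eqVneq p p'.
  rewrite (_ : [set _ | _] = set0) ?cards0//; apply/setP => -[[a u] [a' u']].
  rewrite !inE/=; apply/negP => /andP[/and4P[_ _ n /eqP e] /eqP[aa aa']].
  by rewrite e aa aa' eqxx in n.
apply: leq_trans (UO _ _ pP p'P ne).
rewrite -(card_in_imset (f := fun w => w.1.2)).
  apply/subset_leq_card/subsetP => _ /imsetP[[[a u] [a' u']] + ->]; rewrite !inE/=.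
  by case/andP => /and4P[/andP[_ h] /andP[_ h'] _ /eqP e] /eqP[<- <-]; rewrite h e h'.
move=> [[a u] [a' u']] [[b z] [b' z']]; rewrite !inE/=.
by case/andP => /and4P[_ _ _ /eqP<-] /eqP[-> ->] /andP[/and4P[_ _ _ /eqP<-] /eqP[-> ->]] ->.
Qed.

Lemma card_ord_pairs m :
  m ^ 2 = (2 * #|[set p : 'I_m * 'I_m | p.1 < p.2]| + m)%N.
Proof.
rewrite !card_set_sum -(pair_bigA _ (fun i j : 'I_m => nat_of_bool (i < j)%N))/=.
have -> : m ^ 2 = \sum_(i < m) \sum_(j < m) ((i < j)%N + (j < i)%N + (i == j)).
  transitivity (\sum_(i < m) \sum_(j < m) 1).
    by under eq_bigr do rewrite sum_nat_const card_ord muln1; rewrite sum_nat_const card_ord.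
  by do 2![apply: eq_bigr => ? _]; rewrite -val_eqE/=; case: ltngtP.
under [LHS]eq_bigr do rewrite !big_split/=.
rewrite !big_split/= [X in _ + X + _]exchange_big/= addnn -mul2n; congr (_ + _).
rewrite -[RHS]card_ord -sum1_card; apply: eq_bigr => i _.
by rewrite (bigD1 i)//= eqxx big1// => j /negPf; rewrite eq_sym => ->.
Qed.

(** Indices of weight below [E / (2 * #|I|)] carry at most half of [E]. The others fall into
    [trunc_log 2 n + 1] dyadic classes, one of which carries its share. Its weights are below
    [2 * 2 ^ k] yet at least [E / (2 * #|I|)], whence the last bound. *)
Lemma dyadic_level (I : finType) (w : I -> nat) (E n : nat) :
  0 < E -> E <= \sum_i w i -> (forall i, w i <= n) ->
  exists k, [/\ 2 ^ k <= n,
    E <= 4 * (trunc_log 2 n).+1 * #|[set i | 2 ^ k <= w i]| * 2 ^ k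
    & E <= 4 * #|I| * 2 ^ k].
Proof.
move=> E0 Ew wn; set L := trunc_log 2 n.
have I0 : 0 < #|I|.
  by rewrite lt0n; apply/eqP => /card0_eq I0; move: Ew; rewrite big_pred0//; lia.
pose good i := E <= 2 * #|I| * w i.
have bad : 2 * \sum_(i | ~~ good i) w i <= E.
  rewrite -(leq_pmul2l I0) mulnA (mulnC #|I|) big_distrr/=.
  apply: (@leq_trans (\sum_(i | ~~ good i) E)).
    by apply: leq_sum => i; rewrite -ltnNge => /ltnW.
  by rewrite sum_nat_const leq_mul2r max_card orbT.
have Eg : E <= 2 * \sum_(i | good i) w i.
  by move: Ew bad; rewrite (bigID good)/=; lia.
have lev i : trunc_log 2 (w i) < L.+1 by rewrite ltnS leq_trunc_log.
have [k kP] : exists k : 'I_L.+1,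
    E <= 2 * L.+1 * \sum_(i | good i && (trunc_log 2 (w i) == k)) w i.
  apply/existsP; apply: contraT => /existsPn H.
  have: \sum_(k < L.+1) (2 * L.+1 * \sum_(i | good i && (trunc_log 2 (w i) == k)) w i).+1
    <= \sum_(k < L.+1) E by apply: leq_sum => k _; have := H k; rewrite -ltnNge.
  under eq_bigr do rewrite -addn1.
  rewrite big_split/= -big_distrr/= !sum_nat_const card_ord muln1.
  move: Eg; rewrite (partition_big (fun i => Ordinal (lev i)) xpredT)//=.
  under eq_bigr do under eq_bigl do rewrite -val_eqE/=.
  nia.
have wk i : good i && (trunc_log 2 (w i) == k) -> 2 ^ k <= w i < 2 * 2 ^ k.
  move=> /andP[gi /eqP <-]; have w0 : 0 < w i by move: gi; rewrite /good; case: (w i) => //; lia.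
  by rewrite -expnS; apply: trunc_log_bounds.
have [i ik] : exists i, good i && (trunc_log 2 (w i) == k).
  apply/existsP; apply: contraT => /existsPn H; move: kP.
  by rewrite big_pred0 ?muln0; [lia|move=> i; apply/negbTE/H].
exists k; split.
- by have /andP[/leq_trans+ _] := wk i ik; apply.
- apply: leq_trans kP _.
  apply: (@leq_trans (2 * L.+1 * (#|[set i | 2 ^ k <= w i]| * (2 * 2 ^ k)))); last by lia.
  rewrite leq_mul2l -sum_nat_const big_mkcond [leqRHS]big_mkcond/=.
  apply: leq_sum => l _; rewrite inE; case: ifP => // /wk /andP[-> /ltnW//].
- have /andP[_ lt] := wk i ik; case/andP: ik => + _; rewrite /good => gi.
  apply: leq_trans gi _; nia.
Qed.

(** Ensures that, despite the logarithmic loss, the rich slopes number at least a constant times the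
    square root of [n], enough to fill a cluster. *)
Lemma sqr_trunc_log_le n : 0 < n -> (trunc_log 2 n).+1 ^ 2 <= 4 * n.
Proof.
move=> n0; apply: (@leq_trans (4 * 2 ^ trunc_log 2 n)); last first.
  by rewrite leq_mul2l trunc_logP.
elim: (trunc_log 2 n) => [//|L IH]; rewrite (expnS 2 L).
case: L IH => [|[|L]] //; move: (2 ^ _) => e; rewrite -!mulnn; nia.
Qed.

Local Open Scope fset_scope.
Local Open Scope ring_scope.

(** * Mediants and the curves on which two mediants agree *)

(** Slope of the sum of the points [(x, l * x)] and [(y, l' * y)], taken on the lines through the
    origin of slopes [l] and [l']. *)
Definition mediant (R : realFieldType) (l x l' y : R) : R :=
  (l * x + l' * y) / (x + y).

Lemma mediant_between (R : realFieldType) (l x l' y : R) :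
  0 < x -> 0 < y -> l < l' -> l < mediant l x l' y < l'.
Proof.
move=> x0 y0 ll; rewrite /mediant ltr_pdivlMr ?ltr_pdivrMr; try by rewrite addr_gt0.
by apply/andP; split; nra.
Qed.

Lemma mediant_inj (R : realFieldType) (l x l' y y' : R) :
  0 < x -> 0 < y -> 0 < y' -> l < l' ->
  mediant l x l' y = mediant l x l' y' -> y = y'.
Proof.
move=> x0 y0 y0' ll; rewrite /mediant => /eqP.
rewrite eqr_div ?lt0r_neq0 ?addr_gt0// => /eqP e.
have : (x * (l' - l)) * (y - y') = 0.
  by rewrite -(subrr ((l * x + l' * y) * (x + y'))) {2}e; ring.
by move=> /eqP; rewrite !mulf_eq0 !subr_eq0 (gt_eqF x0) (gt_eqF ll)/= => /eqP.
Qed.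

Lemma mediant_mono (R : realFieldType) (l x l' y x' : R) :
  0 < x -> 0 < y -> 0 < x' -> l < l' ->
  (mediant l x' l' y <= mediant l x l' y) = (x <= x').
Proof.
move=> x0 y0 x0' ll; rewrite /mediant ler_pdivrMr ?addr_gt0// mulrAC ler_pdivlMr ?addr_gt0//.
rewrite -subr_ge0 -[RHS]subr_ge0.
have -> : (l * x + l' * y) * (x' + y) - (l * x' + l' * y) * (x + y) =
  (y * (l' - l)) * (x' - x) by ring.
by rewrite pmulr_rge0// mulr_gt0// subr_gt0.
Qed.

(** Divided differences at the three roots isolate [a] first, then [b], then [c]. *)
Lemma quadratic3 (R : realFieldType) (a b c x y z : R) :
  x != y -> y != z -> z != x ->
  a * x ^+ 2 + b * x + c = 0 -> a * y ^+ 2 + b * y + c = 0 ->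
  a * z ^+ 2 + b * z + c = 0 -> [/\ a = 0, b = 0 & c = 0].
Proof.
rewrite -(subr_eq0 x) -(subr_eq0 y) -(subr_eq0 z) => xy yz zx ex ey ez.
have exy : a * (x + y) + b = 0.
  by apply: (mulfI xy); rewrite mulr0 -(subrr 0) -{1}ex -ey; ring.
have eyz : a * (y + z) + b = 0.
  by apply: (mulfI yz); rewrite mulr0 -(subrr 0) -{1}ey -ez; ring.
have a0 : a = 0.
  by apply: (mulfI zx); rewrite mulr0 -(subrr 0) -{1}eyz -exy; ring.
have b0 : b = 0 by rewrite -exy a0; ring.
by split => //; rewrite -ex a0 b0; ring.
Qed.

(* Through two points of the (p, z)-plane there pass at most two of the curves
   mediant i p j y = mediant k z l w, indexed by (y, w): eliminating w leaves a
   nonzero quadratic equation in y. *)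
Lemma mediant_two_curves (R : realFieldType) (i j k l p1 z1 p2 z2 : R)
    (y w : 'I_3 -> R) :
  i < j -> k < l -> (i, j) != (k, l) -> 0 < p1 -> 0 < z1 -> 0 < p2 -> 0 < z2 ->
  (p1, z1) != (p2, z2) -> (forall e, 0 < y e) -> (forall e, 0 < w e) ->
  (forall e, mediant i p1 j (y e) = mediant k z1 l (w e)) ->
  (forall e, mediant i p2 j (y e) = mediant k z2 l (w e)) ->
  exists e f, e != f /\ (y e, w e) = (y f, w f).
Proof.
move=> ij kl ne p10 z10 p20 z20 ne12 y0 w0 e1 e2.
have inj e f : y e = y f -> w e = w f.
  by move=> yy; apply: (@mediant_inj _ k z1 l) => //; rewrite -!e1 yy.
suff [e [f [ef yy]]] : exists e f, e != f /\ y e = y f.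
  by exists e, f; rewrite yy (inj _ _ yy).
have [yy|y01] := eqVneq (y 0) (y 1); first by exists 0, 1.
have [yy|y12] := eqVneq (y 1) (y 2); first by exists 1, 2.
have [yy|y20] := eqVneq (y 2) (y 0); first by exists 2, 0.
exfalso.
pose a := l - i; pose b := l - j; pose c := i - k; pose d := j - k.
have lin p z e : 0 < p -> 0 < z -> mediant i p j (y e) = mediant k z l (w e) ->
    z * (c * p + d * y e) = w e * (a * p + b * y e).
  move=> pp zz /eqP; rewrite /mediant eqr_div ?lt0r_neq0 ?addr_gt0// => /eqP.
  rewrite /a /b /c /d => /eqP; rewrite -subr_eq0 => /eqP h.
  by apply/eqP; rewrite -subr_eq0 -h; apply/eqP; ring.
have quad e : (b * d * (z1 - z2)) * y e ^+ 2 +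
   (z1 * (c * b * p1 + a * d * p2) - z2 * (c * b * p2 + a * d * p1)) * y e +
   a * c * p1 * p2 * (z1 - z2) = 0.
  have h1 := lin _ _ e p10 z10 (e1 e); have h2 := lin _ _ e p20 z20 (e2 e).
  apply: (mulfI (lt0r_neq0 (w0 e))); rewrite mulr0.
  transitivity ((z1 * (c * p1 + d * y e)) * (w e * (a * p2 + b * y e)) -
    (z2 * (c * p2 + d * y e)) * (w e * (a * p1 + b * y e))); first by ring.
  by rewrite h1 h2; ring.
have [A B C] := quadratic3 y01 y12 y20 (quad 0) (quad 1) (quad 2).
have det : a * d - b * c = (l - k) * (j - i) by rewrite /a /b /c /d; ring.
have det0 : a * d - b * c != 0 by rewrite det mulf_neq0// subr_eq0 gt_eqF.
(* If [z1 = z2], the linear coefficient is [z1 * (p1 - p2)] times the determinant up to sign, which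
   would force the two points to coincide. *)
have [zz|zz] := eqVneq z1 z2.
  move: B; rewrite -zz => B.
  have : z1 * (p1 - p2) * (a * d - b * c) = 0 by rewrite -oppr0 -B; ring.
  move/eqP; rewrite !mulf_eq0 (negPf det0) (gt_eqF z10) orbF/= subr_eq0 => /eqP pp.
  by move: ne12; rewrite pp zz eqxx.
(* Now [b * d = 0] and [a * c = 0]. As the determinant is nonzero, either [b = c = 0] and the slope
   pairs coincide, or [a = d = 0] and [j = k < l = i], against [i < j]. *)
move/eqP: A; rewrite !mulf_eq0 (subr_eq0 z1) (negPf zz) orbF => bd.
move/eqP: C; rewrite !mulf_eq0 (subr_eq0 z1) (negPf zz) (gt_eqF p10) (gt_eqF p20) !orbF => ac.
move: bd ac det0 => /orP[]/eqP u /orP[]/eqP v; rewrite ?u ?v ?mul0r ?mulr0 ?subrr ?eqxx// => _.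
- by move/subr0_eq: u ne => ->; move/subr0_eq: v => ->; rewrite eqxx.
- move/subr0_eq: u kl => <-; move/subr0_eq: v => ->.
  by move/lt_trans => /(_ _ ij); rewrite ltxx.
Qed.

(** An instance of [incidences_le]: points index the first abscissae of the two maps, curves the
    second ones. Both mediants decrease in the first abscissa, so each curve is increasing;
    [mediant_two_curves] supplies the bound 2. *)
Lemma mediant_incidences (R : realFieldType) (V : finType) (v : V -> R)
    (h q : nat) (N := (h * q)%N) (i j k l : R) (f g : 'I_N * 'I_N -> V)
    (X Y Z W : 'I_N -> R) :
  (0 < q)%N -> (0 < h)%N -> i < j -> k < l -> (i, j) != (k, l) ->
  (forall a, 0 < X a) -> (forall a, 0 < Y a) ->
  (forall a, 0 < Z a) -> (forall a, 0 < W a) ->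
  {mono X : a b / (a <= b)%N >-> a <= b} -> {mono Y : a b / (a <= b)%N >-> a <= b} ->
  {mono Z : a b / (a <= b)%N >-> a <= b} -> {mono W : a b / (a <= b)%N >-> a <= b} ->
  (forall w, v (f w) = mediant i (X w.1) j (Y w.2)) ->
  (forall w, v (g w) = mediant k (Z w.1) l (W w.2)) ->
  (\sum_(c : 'I_N * 'I_N) #|[set p : 'I_N * 'I_N | f (p.1, c.1) == g (p.2, c.2)]|
     <= N ^ 2 * (2 * h) + 2 * (N * q) ^ 2)%N.
Proof.
move=> q0 h0 ij kl ne X0 Y0 Z0 W0 Xm Ym Zm Wm vf vg.
have inj (F : 'I_N -> R) : {mono F : a b / (a <= b)%N >-> a <= b} -> injective F.
  by move=> Fm a b e; apply/val_inj/eqP; rewrite eqn_leq -!Fm e lexx.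
have eqI p c : f (p.1, c.1) == g (p.2, c.2) ->
    mediant i (X p.1) j (Y c.1) = mediant k (Z p.2) l (W c.2).
  by move=> /eqP/(congr1 v); rewrite vf vg.
have -> : (N ^ 2 = #|{: 'I_N * 'I_N}|)%N by rewrite card_prod card_ord.
apply: (@incidences_le h q _ (fun p c => f (p.1, c.1) == g (p.2, c.2))) => //.
  move=> c p p' /eqI e /eqI e'.
  rewrite -Xm -(@mediant_mono _ i _ j (Y c.1))// e e' mediant_mono//.
  by rewrite Zm.
move=> p p' pp'; rewrite leqNgt; apply/negP => /card_gt2P[c0 [c1 [c2 [[+ + +] [c01 c12 c20]]]]].
rewrite !inE => /andP[/eqI e0 /eqI e0'] /andP[/eqI e1 /eqI e1'] /andP[/eqI e2 /eqI e2'].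
pose c (e : 'I_3) := nth c0 [:: c0; c1; c2] e.
have [|e|e|e|e|e [e' [ee [Ye We]]]] := @mediant_two_curves _ i j k l (X p.1) (Z p.2) (X p'.1) (Z p'.2)
   (fun e => Y (c e).1) (fun e => W (c e).2) ij kl ne (X0 _) (Z0 _) (X0 _) (Z0 _).
- apply: contraNN pp' => /eqP[/(inj _ Xm) e /(inj _ Zm) e'].
  by rewrite [p]surjective_pairing [p']surjective_pairing e e'.
- by [].
- by [].
- by case: e => [[|[|[|]]]].
- by case: e => [[|[|[|]]]].
have : c e = c e'.
  by rewrite [LHS]surjective_pairing [RHS]surjective_pairing (inj _ Ym _ _ Ye) (inj _ Wm _ _ We).
have cu : uniq [:: c0; c1; c2] by rewrite /= !inE negb_or c01 c12 (eq_sym c0) c20.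
by move/eqP; rewrite nth_uniq// val_eqE (negPf ee).
Qed.

(** * Mediants within one cluster of slopes, then over all clusters *)

(** [N] points are used on each line, [q] is the side of a cell, [h] the number of cells along a
    side of the grid, and [t = N / (2 * m ^ 2)] the popularity threshold. *)
Lemma mediant_cluster (R : realFieldType) (V : finType) (v : V -> R) (D : {set V})
    (m t h : nat) (q := (32 * m ^ 6)%N) (N := (h * q)%N) (lam : 'I_m -> R)
    (X : 'I_m -> 'I_N -> R) (s : 'I_m -> 'I_N -> 'I_m -> 'I_N -> V) :
  (1 < m)%N -> N = (2 * m ^ 2 * t)%N -> (2 ^ 15 * m ^ 18 <= N)%N ->
  (forall i j : 'I_m, (i < j)%N -> lam i < lam j) ->
  (forall i a, 0 < X i a) ->
  (forall i, {mono X i : a b / (a <= b)%N >-> a <= b}) ->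
  (forall (i j : 'I_m) a c, (i < j)%N -> s i a j c \in D /\
     v (s i a j c) = mediant (lam i) (X i a) (lam j) (X j c)) ->
  (m ^ 2 * N <= 16 * #|D|)%N.
Proof.
move=> m1 Nt mN lamm X0 Xm sP.
have m0 : (0 < m)%N by lia.
have q0 : (0 < q)%N by rewrite muln_gt0 expn_gt0 m0.
have N0 : (0 < N)%N by apply: leq_trans mN; rewrite muln_gt0 !expn_gt0 m0.
have h0 : (0 < h)%N by move: N0; rewrite /N muln_gt0 => /andP[].
have t0 : (0 < t)%N by case: t Nt => // Nt; rewrite Nt muln0 in N0.
pose P := [set p : 'I_m * 'I_m | (p.1 < p.2)%N].
pose f (p : 'I_m * 'I_m) (w : 'I_N * 'I_N) := s p.1 w.1 p.2 w.2.
have fD p w : p \in P -> f p w \in D by rewrite inE => /(sP _ _ w.1 w.2)[].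
have vf p w : p \in P -> v (f p w) = mediant (lam p.1) (X p.1 w.1) (lam p.2) (X p.2 w.2).
  by rewrite inE => /(sP _ _ w.1 w.2)[].
have lamP p : p \in P -> lam p.1 < lam p.2 by rewrite inE => /lamm.
have laminj : injective lam.
  move=> i j e; apply/val_inj; case: (ltngtP i j) => // /lamm; by rewrite e ltxx.
have Xinj i : injective (X i).
  by move=> a b e; apply/val_inj/eqP; rewrite eqn_leq -!(Xm i) e lexx.
have Pm := card_ord_pairs m; rewrite -/P in Pm.
(* One pair with more than [m ^ 2 * N] values settles the claim; otherwise every pair satisfies the
   image bound of [popular_card]. *)
have [/existsP[p /andP[pP big]]|/existsPn small] :=
    boolP [exists p, (p \in P) && (m ^ 2 * N < #|f p @: setT|)%N].
  apply: (@leq_trans #|f p @: setT|); first exact: ltnW.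
  apply: (@leq_trans #|D|); last by lia.
  by apply/subset_leq_card/subsetP => _ /imsetP[w _ ->]; exact: fD.
pose U p := [set u | (t <= #|f p @^-1: [set u]|)%N].
have UN p : p \in P -> (N <= 2 * #|U p|)%N.
  move=> pP; apply: (@popular_card _ _ (m ^ 2 * N) t (f p)).
  - move=> a c c' /(congr1 v); rewrite !vf//= => /mediant_inj e.
    by apply: (Xinj p.2); apply: e => //; exact: lamP.
  - by move: (small p); rewrite pP -leqNgt.
  - have e : (N * N = 2 * m ^ 2 * t * N)%N by rewrite {1}Nt.
    by apply: eq_leq; rewrite -(mulnn N) e; clear; move: N; lia.
(* [O] is the incidence bound divided by [t ^ 2], using [N ^ 2 = 4 * m ^ 4 * t ^ 2]. *)
pose O := (8 * m ^ 4 * (h + q ^ 2))%N.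
have UO : {in P &, forall p p', p != p' -> (#|U p :&: U p'| <= O)%N}.
  move=> p p' pP p'P pp'.
  have := leq_trans (popular_overlap t (f p) (f p'))
    (mediant_incidences q0 h0 (lamP _ pP) (lamP _ p'P) _ (X0 _) (X0 _) (X0 _) (X0 _)
      (Xm _) (Xm _) (Xm _) (Xm _) (fun w => vf p w pP) (fun w => vf p' w p'P)).
  rewrite -/(U p) -/(U p') => H.
  rewrite -(@leq_pmul2r (t ^ 2)) ?expn_gt0 ?t0//.
  apply: leq_trans (H _) _.
    apply: contraNN pp' => /eqP[/laminj e /laminj e'].
    by rewrite [p]surjective_pairing [p']surjective_pairing e e'.
  rewrite -/N expnMn {1 2}Nt /O; nia.
have UD : {in P, forall p, U p \subset D}.
  move=> p pP; apply/subsetP => u; rewrite inE => /(leq_trans t0)/card_gt0P[w].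
  by rewrite inE => /set1P <-; exact: fD.
have := sum_card_le_union UD UO.
have : (N * #|P| <= 2 * \sum_(p in P) #|U p|)%N.
  by rewrite mulnC -sum_nat_const big_distrr leq_sum.
move=> le1 le2.
(* Since [2 * #|P| <= m ^ 2], two terms remain: the choice of [q] makes the one with [h] equal to
   [N / 2], and [2 ^ 15 * m ^ 18 <= N] bounds the one with [q ^ 2] by [N / 2]. *)
have PO : (4 * (#|P| * O) <= N)%N.
  apply: (@leq_trans (2 * m ^ 2 * O)%N); first by nia.
  have -> : (2 * m ^ 2 * O = 16 * m ^ 6 * h + 2 ^ 14 * m ^ 18)%N.
    by rewrite /O /q; ring.
  have : (2 * (16 * m ^ 6 * h) = N)%N by rewrite /N /q; ring.
  lia.
have : (N * #|P| <= 4 * #|D|)%N.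
  have : (4 * (#|P| ^ 2 * O) <= #|P| * N)%N by rewrite -mulnn -mulnA mulnCA leq_mul2l PO orbT.
  lia.
have m2 : (2 * m <= m ^ 2)%N by rewrite -mulnn leq_mul2r m1 orbT.
have : (m ^ 2 * N <= 4 * #|P| * N)%N by rewrite leq_mul2r; apply/orP; right; lia.
lia.
Qed.
(** The mediants of a block of [m] consecutive slopes lie strictly between its extreme slopes, so
    distinct blocks have disjoint value sets and the cluster bounds add up. *)
Lemma mediants_card (R : realFieldType) (V : finType) (v : V -> R)
    (S m t h : nat) (N := (h * (32 * m ^ 6))%N) (lam : 'I_S -> R)
    (X : 'I_S -> 'I_N -> R) (s : 'I_S -> 'I_N -> 'I_S -> 'I_N -> V) :
  (1 < m)%N -> (m <= S)%N -> N = (2 * m ^ 2 * t)%N -> (2 ^ 15 * m ^ 18 <= N)%N ->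
  (forall i j : 'I_S, (i < j)%N -> lam i < lam j) ->
  (forall i a, 0 < X i a) ->
  (forall i, {mono X i : a b / (a <= b)%N >-> a <= b}) ->
  (forall (i j : 'I_S) a c,
     v (s i a j c) = mediant (lam i) (X i a) (lam j) (X j c)) ->
  (S * m * N <= 32 * #|V|)%N.
Proof.
move=> m1 mS Nt mN lamm X0 Xm sP.
have m0 : (0 < m)%N by lia.
have embP (g : 'I_(S %/ m)) (i : 'I_m) : (g * m + i < S)%N.
  apply: (@leq_trans (g.+1 * m)); first by rewrite mulSn addnC ltn_add2r.
  by apply: leq_trans (leq_trunc_div S m); rewrite leq_mul2r ltn_ord orbT.
pose emb g i := Ordinal (embP g i).
pose D g := [set u | [exists i, lam (emb g i) < v u] && [exists j, v u < lam (emb g j)]].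
have Dm g : (m ^ 2 * N <= 16 * #|D g|)%N.
  apply: (@mediant_cluster _ _ v (D g) m t h (lam \o emb g) (fun i => X (emb g i))
    (fun i a j c => s (emb g i) a (emb g j) c)) => //.
    by move=> i j ij; apply: lamm; rewrite /= ltn_add2l.
  move=> i j a c ij; split=> //; rewrite inE.
  have gij : (emb g i < emb g j)%N by rewrite ltn_add2l.
  have := mediant_between (X0 (emb g i) a) (X0 (emb g j) c) (lamm _ _ gij).
  move=> /andP[lo hi].
  by apply/andP; split; apply/existsP; [exists i|exists j]; rewrite sP.
have D0 : {in [set: 'I_(S %/ m)] &, forall g g', g != g' -> (#|D g :&: D g'| <= 0)%N}.
  move=> g g' _ _; wlog gg : g g' / (g < g')%N.
    move=> H ne; case: (ltngtP g g') => gg; first exact: H.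
      by rewrite setIC H// eq_sym.
    by rewrite -val_eqE/= gg eqxx in ne.
  move=> _; rewrite leqn0 cards_eq0 -subset0; apply/subsetP => u; rewrite !inE.
  move=> /andP[/andP[_ /existsP[j uj]] /andP[/existsP[i iu] _]].
  have := lt_trans (lt_trans uj (lamm (emb g j) (emb g' i) _)) iu.
  rewrite ltxx; apply; rewrite /=.
  apply: (@leq_trans (g' * m)); last exact: leq_addr.
  apply: (@leq_trans (g.+1 * m)); last by rewrite leq_mul2r gg orbT.
  by rewrite mulSn addnC ltn_add2r.
have := sum_card_le_union (U := D) (D := setT) (fun g _ => subsetT _) D0.
rewrite muln0 addn0 cardsT => le1.
have : (S %/ m * (m ^ 2 * N) <= 16 * #|V|)%N.
  apply: leq_trans (leq_mul (leqnn 16) le1).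
  rewrite -{1}(card_ord (S %/ m)) -cardsT -sum_nat_const big_distrr leq_sum//.
(* Dropping the incomplete last block costs at most a factor 2, because [m <= S]. *)
have : (S * m * N <= 2 * (S %/ m * (m ^ 2 * N)))%N.
  have -> : (2 * (S %/ m * (m ^ 2 * N)) = (2 * (S %/ m * m)) * m * N)%N by rewrite -(mulnn m); lia.
  rewrite !leq_mul2r; apply/orP; right; apply/orP; right.
  have := ltn_ceil S m0; have : (0 < S %/ m)%N by rewrite divn_gt0.
  rewrite mulSn; nia.
lia.
Qed.

(** * Slopes and fibres of a set of positive reals *)

Lemma sort_nth_mono (R : realFieldType) (s : seq R) (n : nat) :
  uniq s -> (n <= size s)%N ->
  {mono (fun a : 'I_n => nth 0 (sort <=%R s) a) : a b / (a <= b)%N >-> a <= b}.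
Proof.
move=> us ns a b; rewrite lt_sorted_leq_nth ?sort_lt_sorted//= inE size_sort.
- exact: leq_trans (ltn_ord a) ns.
- exact: leq_trans (ltn_ord b) ns.
Qed.

Lemma sort_nth_mem (R : realFieldType) (s : seq R) (n : nat) (a : 'I_n) :
  (n <= size s)%N -> nth 0 (sort <=%R s) a \in s.
Proof.
by move=> ns; rewrite -(mem_sort <=%R) mem_nth// size_sort (leq_trans (ltn_ord a)).
Qed.

(** Pairs of elements of [B] are counted by slope: for fixed [x], the quotients [y / x] with [y] in
    [B] are distinct, and each sends [x] back into [B]. *)
Lemma sum_card_slopes_ge (R : realType) (B : {fset R}) :
  (forall b, b \in B -> 0 < b) ->
  (#|` B| ^ 2 <= \sum_(l : ratioset B B) size [seq x <- B | (val l * x)%R \in B])%N.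
Proof.
move=> B0.
under eq_bigr do rewrite size_filter -sum1_count big_mkcond.
rewrite exchange_big/= -mulnn -[X in (X * _)%N](size_map id) map_id.
rewrite -[X in (X * _)%N]sum1_size big_distrl/= big_seq [leqRHS]big_seq.
apply: leq_sum => x xB; rewrite mul1n.
have memQ (y : B) : val y / x \in ratioset B B.
  by apply/ratiosetP; exists (val y), x; split => //; [exact: valP|exact/lt0r_neq0/B0].
pose f (y : B) : ratioset B B := [` memQ y].
have finj : injective f.
  move=> y y' /(congr1 val)/= /(mulIf (invr_neq0 (lt0r_neq0 (B0 _ xB)))).
  exact: val_inj.
rewrite cardfE -(card_imset _ finj) -sum1_card big_mkcond/=.
apply: leq_sum => l _; case: ifP => // /imsetP[y _ ->].
by rewrite /= divfK ?lt0r_neq0 ?B0// (valP y).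
Qed.

Lemma mediant_in_sum_ratioset (R : realType) (B : {fset R}) (l x l' y : R) :
  (forall b, b \in B -> 0 < b) ->
  x \in B -> l * x \in B -> y \in B -> l' * y \in B ->
  mediant l x l' y \in sum_ratioset B.
Proof.
move=> B0 xB lxB yB lyB; apply/sum_ratiosetP.
by exists (l * x), (l' * y), x, y; split=> //; rewrite lt0r_neq0// addr_gt0 ?B0.
Qed.

Lemma ratioset_sub_sum_ratioset (R : realType) (B : {fset R}) :
  ratioset B B `<=` sum_ratioset B.
Proof.
apply/fsubsetP => _ /ratiosetP[a [b [aB bB b0 ->]]]; apply/sum_ratiosetP.
exists a, a, b, b; split=> //; first by rewrite -mulr2n mulrn_eq0.
by rewrite -!mulr2n -mulr_natr -[in RHS](mulr_natr b) -mulf_div divff ?mulr1 ?pnatr_eq0.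
Qed.

(** The cluster size [m] links the two inequalities and is eliminated in the end. The second one
    follows from [2 ^ k <= 2 ^ 32 * m ^ 18] and [m ^ 18 <= m ^ 25]. *)
Lemma sum_ratioset_growth (R : realType) (B : {fset R}) (n := #|` B|) (C : nat) :
  (2 ^ 35 <= C)%N -> (forall b, b \in B -> 0 < b) -> (0 < n)%N ->
  exists m, (m * n ^ 2 <= C * (trunc_log 2 n).+1 * #|` sum_ratioset B|)%N /\
            (n ^ 2 <= C * m ^ 25 * #|` ratioset B B|)%N.
Proof.
move=> C35 B0 n0; have Cle x : (2 ^ 35 * x <= C * x)%N by rewrite leq_mul2r C35 orbT.
 set Q := ratioset B B; set T := sum_ratioset B.
pose fib (l : R) := [seq x <- B | l * x \in B].
have wn (l : Q) : (size (fib (val l)) <= n)%N by rewrite size_filter count_size.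
have n20 : (0 < n ^ 2)%N by rewrite expn_gt0 n0.
have [k [kn kS kQ]] := dyadic_level n20 (sum_card_slopes_ge B0) wn.
set L := (trunc_log 2 n).+1 in kS *; set Ss := [set i | _] in kS.
set S := #|Ss| in kS; rewrite -cardfE in kQ.
have SQ : (S <= #|` Q|)%N by rewrite cardfE max_card.
have QT : (#|` Q| <= #|` T|)%N by exact/fsubset_leq_card/ratioset_sub_sum_ratioset.
(* When lines carry boundedly many points, [m = 1] works, because there are at least as many sum
   ratios as ratios. The threshold is [33 = 15 + 18], so that [j] below is at least 1. *)
have [k33|k33] := ltnP k 33.
  have k32 : (2 ^ k <= 2 ^ 32)%N by rewrite leq_pexp2l.
  exists 1%N; rewrite mul1n exp1n muln1; split.
    apply: leq_trans kS _.
    apply: (@leq_trans (4 * L * #|` T| * 2 ^ 32)); last first.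
      by rewrite -[leqRHS]mulnA; apply: leq_trans (Cle _); lia.
    by rewrite leq_mul// leq_mul2l (leq_trans SQ QT) orbT.
  apply: leq_trans kQ _.
  apply: (@leq_trans (4 * #|` Q| * 2 ^ 32)); last first.
    by apply: leq_trans (Cle _); lia.
  by rewrite leq_mul2l k32 orbT.
(* [m] is the largest power of 2 with [2 ^ 15 * m ^ 18 <= 2 ^ k]. *)
pose j := ((k - 15) %/ 18)%N; pose m := (2 ^ j)%N.
have jk : (18 * j + 15 <= k)%N by rewrite /j; lia.
have kj : (k <= 18 * j + 32)%N by rewrite /j; lia.
have m1 : (1 < m)%N by rewrite /m -{1}(expn0 2) ltn_exp2l// /j; lia.
have mk : (2 ^ 15 * m ^ 18 <= 2 ^ k)%N.
  by rewrite /m -expnM -expnD leq_exp2l//; lia.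
have km : (2 ^ k <= 2 ^ 32 * m ^ 18)%N.
  by rewrite /m -expnM -expnD leq_exp2l//; lia.
(* As [m] is a power of 2, [2 ^ k] factors exactly both as [h * (32 * m ^ 6)] and as
   [2 * m ^ 2 * t]. *)
pose h := (2 ^ (k - 5 - 6 * j))%N; pose t := (2 ^ (k - 1 - 2 * j))%N.
have hk : (h * (32 * m ^ 6) = 2 ^ k)%N.
  by rewrite /h /m (_ : 32 = 2 ^ 5)%N// -expnM -!expnD; congr (_ ^ _)%N; lia.
have tk : (2 ^ k = 2 * m ^ 2 * t)%N.
  by rewrite /t /m -expnM -expnS -!expnD; congr (_ ^ _)%N; lia.
(* Together with [64 * m ^ 2 <= 2 ^ 15 * m ^ 18 <= 2 ^ k <= n], this gives [m <= S]: there are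
   enough slopes for one cluster. *)
have nS : (n <= 64 * S ^ 2)%N.
  have a : (n <= 4 * L * S)%N.
    rewrite -(leq_pmul2r n0) mulnn; apply: leq_trans kS _.
    by rewrite leq_mul2l kn orbT.
  have b := sqr_trunc_log_le n0; rewrite -/L in b.
  rewrite -(leq_pmul2r n0); apply: leq_trans (leq_mul a a) _.
  apply: (@leq_trans (16 * S ^ 2 * L ^ 2)); first by lia.
  apply: leq_trans (leq_mul (leqnn _) b) _; lia.
have mS : (m <= S)%N.
  rewrite -leq_sqr -(@leq_pmul2l 64)//; apply: leq_trans nS.
  apply: leq_trans kn; apply: leq_trans mk.
  by rewrite leq_mul// leq_exp2l.
pose ss := [seq val l | l <- enum Ss].
have uss : uniq ss by rewrite map_inj_uniq ?enum_uniq//; exact: val_inj.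
have sss : size ss = S by rewrite size_map -cardE.
pose lam (i : 'I_S) := nth 0 (sort <=%R ss) i.
have lamm : {mono lam : a b / (a <= b)%N >-> a <= b} by apply: sort_nth_mono; rewrite ?sss.
have lamfib i : (2 ^ k <= size (fib (lam i)))%N.
  have : lam i \in ss by apply: sort_nth_mem; rewrite sss.
  by move=> /mapP[l]; rewrite mem_enum inE => + ->.
have ufib l : uniq (fib l) by rewrite filter_uniq ?fset_uniq.
pose X (i : 'I_S) (a : 'I_(h * (32 * m ^ 6))) := nth 0 (sort <=%R (fib (lam i))) a.
have Xfib i a : (X i a \in B) && (lam i * X i a \in B).
  have : X i a \in fib (lam i) by apply: sort_nth_mem; rewrite hk.
  by rewrite mem_filter andbC.
have memT i a i' a' : mediant (lam i) (X i a) (lam i') (X i' a') \in T.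
  by have /andP[? ?] := Xfib i a; have /andP[? ?] := Xfib i' a'; exact: mediant_in_sum_ratioset.
have main : (S * m * 2 ^ k <= 32 * #|` T|)%N.
  rewrite -hk cardfE.
  apply: (@mediants_card _ T val S m t h lam X (fun i a i' a' => [` memT i a i' a'])) => //.
  - by rewrite hk.
  - by rewrite hk.
  - by move=> i i' ii'; rewrite ltNge lamm -ltnNge.
  - by move=> i a; have /andP[/B0] := Xfib i a.
  - by move=> i; apply: sort_nth_mono; rewrite ?hk.
exists m; split.
  apply: (@leq_trans (m * (4 * L * S * 2 ^ k))); first by rewrite leq_mul2l kS orbT.
  apply: (@leq_trans (4 * L * (S * m * 2 ^ k))); first by lia.
  apply: (@leq_trans (4 * L * (32 * #|` T|))); first by rewrite leq_mul2l main orbT.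
  by rewrite -[leqRHS]mulnA; apply: leq_trans (Cle _); lia.
apply: leq_trans kQ _.
apply: (@leq_trans (4 * #|` Q| * (2 ^ 32 * m ^ 25))); last first.
  by rewrite -[leqRHS]mulnA; apply: leq_trans (Cle _); lia.
rewrite leq_mul2l; apply/orP; right; apply: leq_trans km _.
by rewrite leq_mul2l leq_exp2l// orbT.
Qed.

(** * Reduction to positive sets, passage to real logarithms and elimination of [m] *)

(** [B] is the larger of the positive part and the negated negative part; a common sign cancels in
    every ratio. Discarding 0 leaves [#|A| <= 1 + 2 * #|B|], and [#|A| >= 2] makes [B] nonempty,
    whence the factor 3. *)
Lemma pos_or_neg_part (R : realType) (A : {fset R}) : (2 <= #|` A|)%N ->
  exists B : {fset R}, [/\ forall b, b \in B -> 0 < b, (#|` A| <= 3 * #|` B|)%N,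
    (0 < #|` B| <= #|` A|)%N, ratioset B B `<=` ratioset A A
    & sum_ratioset B `<=` sum_ratioset A].
Proof.
move=> A2; pose part (e : R) : {fset R} := [fset e * x | x in [fset x in A | 0 < e * x]].
have partP e b : e * e = 1 -> b \in part e -> 0 < b /\ e * b \in A.
  move=> ee /imfsetP[x /=]; rewrite !inE => /andP[xA ex] ->; split => //.
  by rewrite mulrA ee mul1r.
have card_part e : e * e = 1 -> #|` part e| = #|` [fset x in A | 0 < e * x]|.
  move=> ee; rewrite card_imfset//= => x y /(congr1 ( *%R e)).
  by rewrite !mulrA ee !mul1r.
have sub : A `<=` 0 |` ([fset x in A | 0 < 1 * x] `|` [fset x in A | 0 < -1 * x]).
  apply/fsubsetP => x xA; rewrite !inE xA/= mul1r mulN1r oppr_gt0.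
  by case: ltgtP.
have := fsubset_leq_card sub; rewrite cardfsU1.
have := leq_card_fsetU [fset x in A | 0 < 1 * x] [fset x in A | 0 < -1 * x].
rewrite -!card_part ?mulr1 ?mulrNN ?mulr1// => -[le1 _] le2.
have [e [ee Ae]] : exists e, e * e = 1 /\ (#|` A| <= 1 + 2 * #|` part e|)%N.
  case: (leqP #|` part 1| #|` part (-1)|) => le3.
    by exists (-1); split; [rewrite mulrNN mulr1|lia].
  by exists 1; split; [rewrite mulr1|lia].
have e0 : e != 0 by apply/eqP => e0; move/eqP: ee; rewrite e0 mulr0 eq_sym oner_eq0.
exists (part e); split.
- by move=> b /(partP _ _ ee)[].
- lia.
- apply/andP; split; first lia.
  by rewrite card_part//; apply/fsubset_leq_card/fsubsetP => x; rewrite !inE => /andP[].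
- apply/fsubsetP => _ /ratiosetP[a [b [/(partP _ _ ee)[_ aA] /(partP _ _ ee)[_ bA] b0 ->]]].
  by apply/ratiosetP; exists (e * a), (e * b); rewrite mulf_neq0// -mulf_div divff ?mul1r.
- apply/fsubsetP => _ /sum_ratiosetP[a [b [c [d [[/(partP _ _ ee)[_ aA] /(partP _ _ ee)[_ bA]
    /(partP _ _ ee)[_ cA] /(partP _ _ ee)[_ dA]] cd ->]]]]].
  apply/sum_ratiosetP; exists (e * a), (e * b), (e * c), (e * d); rewrite -!mulrDr.
  by rewrite mulf_neq0// -mulf_div divff ?mul1r.
Qed.

Lemma trunc_log_le_log2 (R : realType) (n : nat) : (2 <= n)%N ->
  1 <= log2 (n%:R : R) /\ (trunc_log 2 n).+1%:R <= 2 * log2 (n%:R : R).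
Proof.
move=> n2; have n0 : (0 < n)%N by lia.
have l2 : 0 < ln 2 :> R by rewrite ln_gt0// ltr1n.
have lnat (k : nat) : (2 ^ k <= n)%N -> k%:R <= log2 (n%:R : R).
  move=> kn; rewrite /log2 ler_pdivlMr// mulr_natl -lnXn//.
  by rewrite ler_ln ?posrE ?exprn_gt0 ?ltr0n// -natrX ler_nat.
have h1 : 1 <= log2 (n%:R : R) by rewrite -(mulr1n 1); apply: lnat.
split=> //; have := lnat _ (trunc_logP (isT : (1 < 2)%N) n0).
rewrite -natr1; move: h1; lra.
Qed.

(** In the constant [18 * C], a factor 9 comes from [#|A| ^ 2 <= 9 * #|B| ^ 2] and a factor 2 from
    replacing the integer logarithm by [log2]. *)
Lemma sum_ratioset_bound (R : realType) : exists C : R, 1 <= C /\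
  forall A : {fset R}, (2 <= #|` A|)%N -> exists m : nat,
    m%:R * #|` A|%:R ^+ 2 <= C * log2 (#|` A|%:R) * #|` sum_ratioset A|%:R /\
    #|` A|%:R ^+ 2 <= C * m%:R ^+ 25 * #|` ratioset A A|%:R.
Proof.
have [C C35] : exists C, (2 ^ 35 <= C)%N by move: (2 ^ 35)%N => c; exists c.
have C0 : (0 < C)%N by apply: leq_trans C35; rewrite expn_gt0.
exists (18 * C)%:R; split; first by rewrite ler1n muln_gt0 C0.
move=> A A2; have [B [B0 AB /andP[Bgt0 BA] Q T]] := pos_or_neg_part A2.
have [m [mT mQ]] := sum_ratioset_growth C35 B0 Bgt0; exists m.
have AB2 : (#|` A| ^ 2 <= 9 * #|` B| ^ 2)%N.
  by rewrite (_ : 9 = 3 ^ 2)%N// -expnMn leq_exp2r.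
have [_ logA] := @trunc_log_le_log2 R _ A2.
split.
  rewrite -natrX -natrM.
  have le1 : (m * #|` A| ^ 2 <= (9 * C) * (trunc_log 2 #|` A|).+1 * #|` sum_ratioset A|)%N.
    apply: (@leq_trans (9 * (m * #|` B| ^ 2))); first by rewrite mulnCA leq_mul2l AB2 orbT.
    rewrite -!mulnA leq_mul2l/=; apply: leq_trans mT _; rewrite -mulnA leq_mul2l.
    apply/orP; right; apply: leq_mul; last exact: fsubset_leq_card.
    by rewrite ltnS leq_trunc_log.
  have := le1; rewrite -(ler_nat R) => /le_trans; apply.
  rewrite !natrM; apply: ler_wpM2r => //.
  have -> : 18%:R * C%:R * log2 #|` A|%:R = 9%:R * C%:R * (2 * log2 #|` A|%:R) :> R by ring.
  by apply: ler_wpM2l => //; rewrite mulr_ge0.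
rewrite -!natrX -!natrM ler_nat; apply: leq_trans AB2 _.
apply: (@leq_trans (9 * (C * m ^ 25 * #|` ratioset B B|))); first by rewrite leq_mul2l mQ.
have := fsubset_leq_card Q; move: (m ^ 25)%N => M QQ.
rewrite -!mulnA; apply: leq_mul => //; rewrite !leq_mul2l QQ !orbT//.
Qed.

(** For the first claim, the 25th root of the second inequality of [sum_ratioset_bound] bounds [m]
    from below, which is inserted into the first. For the second claim, the hypothesis turns the
    first inequality into [m <= C * K * log2 #|A|], which is inserted into the second. *)
Theorem theorem1p1 (R : realType) :
  (exists c : R, 0 < c /\
     forall A : {fset R}, (2 <= #|` A|)%N ->
       c * ((#|` A|%:R `^ (2 + 2 / 25)) /
            (#|` ratioset A A|%:R `^ (1 / 25) * log2 (#|` A|%:R)))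
         <= #|` sum_ratioset A|%:R)
  /\
  (forall K : R, 0 < K ->
     exists cK : R, 0 < cK /\
       forall A : {fset R}, (2 <= #|` A|)%N ->
         #|` sum_ratioset A|%:R <= K * #|` A|%:R ^+ 2 ->
         cK * (#|` A|%:R ^+ 2 / log2 (#|` A|%:R) ^+ 25)
           <= #|` ratioset A A|%:R).
Proof.
have [C [C1 HC]] := sum_ratioset_bound R.
have C0 : 0 < C by apply: lt_le_trans C1.
have C0' := ltW C0.
split.
  exists (C ^- 2); split; first by rewrite invr_gt0 exprn_gt0.
  move=> A A2; have [m [mT mQ]] := HC A A2.
  have [l1 _] := @trunc_log_le_log2 R _ A2.
  have l0 : 0 < log2 #|` A|%:R :> R by apply: lt_le_trans l1.
  have A0 : 0 < #|` A|%:R :> R by rewrite ltr0n; lia.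
  have Q0 : 0 < #|` ratioset A A|%:R :> R.
    rewrite ltr0n lt0n; apply/eqP => Q0.
    by move: mQ; rewrite Q0 mulr0 leNgt exprn_gt0.
  move: mT mQ; set a := #|` A|%:R in A0 l0 l1 *; set q := #|` ratioset A A|%:R in Q0 *.
  set l := log2 a in l0 l1 *; set T := #|` sum_ratioset A|%:R => mT mQ.
  have a0' := ltW A0; have q0' := ltW Q0; have l0' := ltW l0.
  (* As [1 <= C], the factor [C] may be raised to [C ^+ 25], which makes the root exact. *)
  have root : (a ^+ 2) `^ (1 / 25) <= C * m%:R * q `^ (1 / 25).
    apply: (@le_trans _ _ ((C ^+ 25 * m%:R ^+ 25 * q) `^ (1 / 25))).
      apply: ge0_ler_powR; rewrite ?nnegrE ?divr_ge0 ?exprn_ge0 ?mulr_ge0 ?exprn_ge0//.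
      apply: le_trans mQ _; apply: ler_wpM2r => //; apply: ler_wpM2r.
        by rewrite exprn_ge0.
      by rewrite exprS ler_peMr// exprn_ege1.
    rewrite -exprMn powRM ?exprn_ge0 ?mulr_ge0//.
    rewrite -powR_mulrn ?mulr_ge0// -powRrM (_ : 25%:R * (1 / 25) = 1); last by field.
    by rewrite powRr1 ?mulr_ge0.
  have -> : a `^ (2 + 2 / 25) = a ^+ 2 * (a ^+ 2) `^ (1 / 25).
    rewrite powRD; last by apply/implyP => _; rewrite gt_eqF.
    rewrite -powR_mulrn// -powRrM; congr (_ * _ `^ _); by field.
  have q0 : 0 < q `^ (1 / 25) by rewrite powR_gt0.
  rewrite mulrA ler_pdivrMr; last exact: mulr_gt0.
  rewrite mulrC ler_pdivrMr ?exprn_gt0//.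
  apply: (@le_trans _ _ (a ^+ 2 * (C * m%:R * q `^ (1 / 25)))).
    by apply: ler_wpM2l => //; rewrite exprn_ge0//.
  have -> : a ^+ 2 * (C * m%:R * q `^ (1 / 25)) = (m%:R * a ^+ 2) * (C * q `^ (1 / 25)) by ring.
  have -> : T * (q `^ (1 / 25) * l) * C ^+ 2 = (C * l * T) * (C * q `^ (1 / 25)) by ring.
  by apply: ler_wpM2r => //; rewrite mulr_ge0 ?powR_ge0//.
move=> K K0; exists (C * (C * K) ^+ 25)^-1; split.
  by rewrite invr_gt0 !(mulr_gt0, exprn_gt0).
move=> A A2 TK; have [m [mT mQ]] := HC A A2.
have [l1 _] := @trunc_log_le_log2 R _ A2.
have l0 : 0 < log2 #|` A|%:R :> R by apply: lt_le_trans l1.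
have A0 : 0 < #|` A|%:R :> R by rewrite ltr0n; lia.
have K0' := ltW K0.
have l0' := ltW l0.
have mK : m%:R <= C * K * log2 #|` A|%:R.
  rewrite -(ler_pM2r (exprn_gt0 2 A0)); apply: le_trans mT _.
  have -> : C * K * log2 #|` A|%:R * #|` A|%:R ^+ 2 =
    C * log2 #|` A|%:R * (K * #|` A|%:R ^+ 2) by ring.
  by apply: ler_wpM2l => //; rewrite mulr_ge0//.
rewrite mulrA ler_pdivrMr ?exprn_gt0// mulrC ler_pdivrMr ?(mulr_gt0, exprn_gt0)//.
apply: le_trans mQ _.
have -> : #|` ratioset A A|%:R * log2 #|` A|%:R ^+ 25 * (C * (C * K) ^+ 25) =
  C * (C * K * log2 #|` A|%:R) ^+ 25 * #|` ratioset A A|%:R by rewrite !exprMn; ring.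
apply: ler_wpM2r => //; apply: ler_wpM2l => //; apply: lerXn2r mK; rewrite nnegrE //.
exact: mulr_ge0 (mulr_ge0 C0' K0') l0'.
Qed.
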